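(* Let $\Pi=(X,U,F,G,g)$ be an optimal control problem with value function $V$. Then the pointwise upper bound of the value function of any abstraction of $\Pi$ is an upper bound on $V$. If additionally $X$ is a proper metric space, $U$ is a compact metric space, $F$ is compact-valued, and $g$, $G$ and $F$ are upper semi-continuous, then for every $p\in X$ and every $\varepsilon>0$ there exist a neighborhood $N\subseteq X$ of $p$ and some $\rho\in\mathbb{R}_+\setminus\{0\}$ such that $$(N\times\mathbb{R})\cap\operatorname{hypo}W\subseteq B(\operatorname{hypo}V,\varepsilon)$$ holds whenever $W$ is the pointwise upper bound of the value function of an abstraction of conservatism $\rho$ of $\Pi$.
   Context: Conventions: $\mathbb{R}_+=[0,\infty)$, $\mathbb{Z}_+=\{0,1,2,\dots\}$; $\infty+x=\infty$ for $x\in\mathbb{R}$; $\sup\emptyset=0$; $A^B$ is the set of maps $B\to A$. A set-valued map $f\colon A\rightrightarrows B$ assigns to each $a\in A$ a subset $f(a)\subseteq B$ and is identified with the relation $\{(a,b): b\in f(a)\}$; it is strict if $f(a)\neq\emptyset$ for all $a$. Images of sets are written $f(C)=\bigcup_{a\in C}f(a)$, and similarly for several arguments, e.g. $F_1(\Omega,u)=\bigcup_{p\in\Omega}F_1(p,u)$, $g_1(\Omega,\Omega',u)=\{g_1(p,p',u):p\in\Omega,p'\in\Omega'\}$. In a metric space $(X,d)$, $B(c,r)$ and $\bar B(c,r)$ are the open and closed balls, with $\bar B(c,0)=\{c\}$; for a set $M$, $B(M,r)=\bigcup_{c\in M}B(c,r)$ and $\bar B(M,r)=\bigcup_{c\in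 M}\bar B(c,r)$; $d(M,N)=\inf\{d(x,y):x\in M,y\in N\}$; $\operatorname{diam}$ is the diameter. A metric space is proper if every closed ball is compact. For $f\colon X\to[-\infty,\infty]$, $\operatorname{hypo}f=\{(x,\gamma)\in X\times\mathbb{R}:\gamma\le f(x)\}$; $X\times\mathbb{R}$ carries the product (maximum) metric. $f$ is upper semi-continuous if $\operatorname{hypo}f$ is closed; a set-valued $f\colon A\rightrightarrows B$ between metric spaces is upper semi-continuous if $\{a: f(a)\cap\Omega\neq\emptyset\}$ is closed for every closed $\Omega\subseteq B$. System: a triple $(X,U,F)$ with nonempty sets $X,U$ and strict $F\colon X\times U\rightrightarrows X$. A pair $(u,x)\in U^{\mathbb{Z}_+}\times X^{\mathbb{Z}_+}$ is a solution of it if $x(t+1)\in F(x(t),u(t))$ for all $t\in\mathbb{Z}_+$. Controller for $(X,U,F)$: a quintuple $C=(Z,Z_0,\widetilde X,\widetilde U,H)$ of nonempty sets $Z,Z_0,\widetilde X,\widetilde U$ with $Z_0\subseteq Z$, $X\subseteq\widetilde X$, $\widetilde U\subseteq U$, and a strict map $H\colon Z\times\widetilde X\rightrightarrows Z\times\widetilde U\times\{0,1\}$. A quadruple $(u,v,z,x)\in\widetilde U^{\mathbb{Z}_+}\times\{0,1\}^{\mathbb{Z}_+}\times Z^{\mathbb{Z}_+}\times\widetilde X^{\mathbb{Z}_+}$ is a solution of $C$ if $z(0)\in Z_0$ and $(z(t+1),u(t),v(t))\in H(z(t),x(t))$ for all $t\in\mathbb{Z}_+$. $\mathcal{F}(X,U)$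 denotes the collection of all controllers for $(X,U,F)$. Behavior: for a system $S=(X,U,F)$ and $C\in\mathcal{F}(X,U)$, $\mathcal{B}(C\times S)$ is the set of $(u,v,x)\in(U\times\{0,1\}\times X)^{\mathbb{Z}_+}$ for which there is $z\colon\mathbb{Z}_+\to Z$ such that $(u,v,z,x)$ is a solution of $C$ and $(u,x)$ is a solution of $S$; $\mathcal{B}_p(C\times S)=\{(u,v,x)\in\mathcal{B}(C\times S): x(0)=p\}$. Optimal control problem: a tuple $(X,U,F,G,g)$ where $(X,U,F)$ is a system, $G\colon X\to\mathbb{R}_+\cup\{\infty\}$ (terminal cost) and $g\colon X\times X\times U\to\mathbb{R}_+\cup\{\infty\}$ (running cost). Its cost functional $J\colon(U\times\{0,1\}\times X)^{\mathbb{Z}_+}\to[0,\infty]$ is $J(u,v,x)=G(x(T))+\sum_{t=0}^{T-1}g(x(t),x(t+1),u(t))$ if $v\neq0$, where $T=\min v^{-1}(1)$, and $J(u,v,x)=\infty$ if $v=0$. With $S=(X,U,F)$, its value function is $V(p)=\inf_{C\in\mathcal{F}(X,U)}\sup_{(u,v,x)\in\mathcal{B}_p(C\times S)}J(u,v,x)$. Abstraction: let $\Pi_i=(X_i,U_i,F_i,G_i,g_i)$, $i=1,2$, be optimal control problems, where $X_2$ is a cover of $X_1$ (a set of subsets of $X_1$ with union $X_1$) by non-empty subsets. $\Pi_2$ is an abstraction of $\Pi_1$ if the membership relation $Q=\mathop{\in}\colon X_1\rightrightarrows X_2$, $\mathop{\in}(p)=\{\Omega\in X_2:p\in\Omega\}$,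 is a valuated feedback refinement relation from $\Pi_1$ to $\Pi_2$, i.e. $Q$ is strict and for all $(p_1,p_2),(q_1,q_2)\in Q$ and $u\in U_2$: $U_2\subseteq U_1$; $G_1(p_1)\le G_2(p_2)$; $g_1(p_1,q_1,u)\le g_2(p_2,q_2,u)$; $Q(F_1(p_1,u))\subseteq F_2(p_2,u)$. Conservatism: let $\Pi_2$ be an abstraction of $\Pi_1$, let $U_1,X_1$ be metric spaces ($d$ the metric on $X_1$), and let the elements of $X_2$ be closed subsets of $X_1$. Then $\Pi_2$ is an abstraction of conservatism $\infty$ of $\Pi_1$. It is an abstraction of conservatism $\rho\in\mathbb{R}_+$ of $\Pi_1$ if for all $\Omega,\Omega'\in X_2$ and $u\in U_2$: (i) $U_1=\bar B(U_2,\rho)$; (ii) $G_2(\Omega)\le\rho+\sup G_1(\Omega)$; (iii) $g_2(\Omega,\Omega',u)\le\rho+\sup g_1(\Omega,\Omega',u)$; and, if $\Omega$ satisfies $G_1(\Omega)\cup g_1(\Omega,X_1,U_1)\neq\{\infty\}$, additionally (iv) $F_2(\Omega,u)\subseteq\{\Omega''\in X_2: d(\Omega'',F_1(\Omega,u))\le\rho\}$; (v) $\operatorname{diam}(\Omega)\le\rho$. Pointwise upper bound: if $f\colon X_2\to[0,\infty]$, where $X_2$ is the state alphabet of an abstraction of a problem with state alphabet $X_1$, its pointwise upper bound is the function $\hat f\colon X_1\to[0,\infty]$, $\hat f(x)=\sup\{f(\Omega):\Omega\in X_2,\ x\in\Omega\}$. *)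

(* Defs.v *)
From HB Require Import structures.
From mathcomp Require Import all_boot all_order all_algebra.
From mathcomp Require Import all_classical all_reals all_analysis.
Import Order.TTheory GRing.Theory Num.Theory.
Import numFieldNormedType.Exports.

Set Implicit Arguments.
Unset Strict Implicit.
Unset Printing Implicit Defensive.

Local Open Scope classical_set_scope.
Local Open Scope ring_scope.

(* Supremum in [0, +oo]: the convention is sup set0 = 0, whereas
   ereal_sup set0 = -oo.  On nonempty sets of nonnegative elements it agrees
   with ereal_sup. *)
Definition esup0 (R : realType) (A : set (\bar R)) : \bar R :=
  ereal_sup (0%E |` A).

(* The closed ball of a metric space; the library's closed_ball is the closure
   of the open ball, which may be smaller. *)
Definition cball (R : realType) (T : metricType R) (c : T) (r : R) : set T :=
  [set y | mdist c y <= r].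

Definition cballs (R : realType) (T : metricType R) (M : set T) (r : R) :
  set T := \bigcup_(c in M) cball c r.

(* On T * R the library's ball is that of the maximum metric. *)
Definition balls (R : realType) (T : pseudoMetricType R) (M : set T) (r : R) :
  set T := \bigcup_(c in M) ball c r.

Definition setdist (R : realType) (T : metricType R) (M N : set T) : \bar R :=
  ereal_inf [set (mdist x y)%:E | x in M & y in N].

Definition diam (R : realType) (T : metricType R) (M : set T) : \bar R :=
  esup0 [set (mdist x y)%:E | x in M & y in M].

Definition proper_metric (R : realType) (T : metricType R) : Prop :=
  forall (c : T) (r : R), compact (cball c r).

Definition hypo (R : realType) (T : Type) (f : T -> \bar R) : set (T * R) :=
  [set q | (q.2%:E <= f q.1)%E].

Definition usc (R : realType) (T : topologicalType) (f : T -> \bar R) : Prop :=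
  closed (hypo f).

Definition set_usc (A B : topologicalType) (f : A -> set B) : Prop :=
  forall O : set B, closed O -> closed [set a | f a `&` O !=set0].

(* The state and input alphabets are the types X and U. *)
Record system (X U : Type) := System {
  state_nonempty : inhabited X;
  input_nonempty : inhabited U;
  trans :> X -> U -> set X;
  trans_strict : forall x u, trans x u !=set0
}.

Definition system_solution (X U : Type) (S : system X U)
    (u : nat -> U) (x : nat -> X) : Prop :=
  forall t, S (x t) (u t) (x t.+1).

(* The inclusion of X in the larger alphabet Xt is an injection, and the values
   0 and 1 of the stopping signal are false and true.  Nonemptiness of Z follows
   from that of Z0, and nonemptiness of Xt from that of X. *)
Record controller (X U : Type) := Controller {
  ctrl_Z : Type;
  ctrl_Z0 : set ctrl_Z;
  ctrl_Xt : Type;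
  ctrl_incl : X -> ctrl_Xt;
  ctrl_Ut : set U;
  ctrl_H : ctrl_Z -> ctrl_Xt -> set (ctrl_Z * U * bool);
  ctrl_Z0_nonempty : ctrl_Z0 !=set0;
  ctrl_incl_inj : injective ctrl_incl;
  ctrl_Ut_nonempty : ctrl_Ut !=set0;
  ctrl_H_input : forall z x w, ctrl_H z x w -> ctrl_Ut w.1.2;
  ctrl_H_strict : forall z x, ctrl_H z x !=set0
}.

Definition controller_solution (X U : Type) (C : controller X U)
    (u : nat -> U) (v : nat -> bool) (z : nat -> ctrl_Z C)
    (x : nat -> ctrl_Xt C) : Prop :=
  [/\ forall t, ctrl_Ut C (u t),
      ctrl_Z0 (z 0%N) &
      forall t, ctrl_H (z t) (x t) (z t.+1, u t, v t)].

Definition behavior (X U : Type) (C : controller X U) (S : system X U) :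
    set ((nat -> U) * (nat -> bool) * (nat -> X)) :=
  [set w | exists z : nat -> ctrl_Z C,
     controller_solution w.1.1 w.1.2 z (fun t => ctrl_incl C (w.2 t)) /\
     system_solution S w.1.1 w.2].

Definition behavior_at (X U : Type) (C : controller X U) (S : system X U)
    (p : X) : set ((nat -> U) * (nat -> bool) * (nat -> X)) :=
  [set w | behavior C S w /\ w.2 0%N = p].

Record ocp (R : realType) (X U : Type) := OCP {
  ocp_sys :> system X U;
  tcost : X -> \bar R;
  rcost : X -> X -> U -> \bar R;
  tcost_ge0 : forall x, (0 <= tcost x)%E;
  rcost_ge0 : forall x y u, (0 <= rcost x y u)%E
}.

(* ex_minn h is the least t with v t = 1. *)
Definition cost (R : realType) (X U : Type) (P : ocp R X U)
    (w : (nat -> U) * (nat -> bool) * (nat -> X)) : \bar R :=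
  let: (u, v, x) := w in
  match pselect (exists t, v t) with
  | left h => let T := ex_minn h in
      (tcost P (x T) + \sum_(t < T) rcost P (x t) (x t.+1) (u t))%E
  | right _ => +oo%E
  end.

Definition value_function (R : realType) (X U : Type) (P : ocp R X U)
    (p : X) : \bar R :=
  ereal_inf [set c | exists C : controller X U,
                       c = esup0 [set cost P w | w in behavior_at C P p]].

(* The inclusion of U2 in U1 is built into the type of P2. *)
Definition vfrr (R : realType) (X1 U1 X2 : Type) (U2 : set U1)
    (P1 : ocp R X1 U1) (P2 : ocp R X2 U2) (Q : X1 -> set X2) : Prop :=
  (forall p, Q p !=set0) /\
  forall p1 p2 q1 q2 (u : U2), Q p1 p2 -> Q q1 q2 ->
    [/\ (tcost P1 p1 <= tcost P2 p2)%E,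
        (rcost P1 p1 q1 (set_val u) <= rcost P2 p2 q2 u)%E &
        \bigcup_(p in P1 p1 (set_val u)) Q p `<=` P2 p2 u].

Definition membership (X : Type) (X2 : set (set X)) : X -> set X2 :=
  fun p => [set O | set_val O p].

Definition abstraction (R : realType) (X U : Type) (X2 : set (set X))
    (U2 : set U) (P1 : ocp R X U) (P2 : ocp R X2 U2) : Prop :=
  [/\ \bigcup_(O in X2) O = setT,
      forall O, X2 O -> O !=set0 &
      vfrr P1 P2 (@membership X X2)].

Definition abstraction_of_conservatism (R : realType) (X U : metricType R)
    (X2 : set (set X)) (U2 : set U) (P1 : ocp R X U) (P2 : ocp R X2 U2)
    (rho : R) : Prop :=
  [/\ abstraction P1 P2,
      forall O, X2 O -> closed O,
      0 <= rho &
      forall (O O' : X2) (u : U2),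
      [/\ setT = cballs U2 rho,
          (tcost P2 O <= rho%:E + esup0 (tcost P1 @` set_val O))%E,
          (rcost P2 O O' u <= rho%:E +
             esup0 [set rcost P1 p p' (set_val u) |
                    p in set_val O & p' in set_val O'])%E &
          (tcost P1 @` set_val O) `|`
            [set c | exists p q a, set_val O p /\ c = rcost P1 p q a]
            <> [set +oo%E] ->
          P2 O u `<=` [set O'' | (setdist (set_val O'')
             (\bigcup_(p in set_val O) P1 p (set_val u)) <= rho%:E)%E] /\
          (diam (set_val O) <= rho%:E)%E]].

Definition upper_bound_of (R : realType) (X : Type) (X2 : set (set X))
    (f : X2 -> \bar R) (x : X) : \bar R :=
  esup0 [set f O | O in [set O : X2 | set_val O x]].

(* Main.v *)
Require Import Defs.
From HB Require Import structures.
From mathcomp Require Import all_boot all_order all_algebra.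
From mathcomp Require Import all_classical all_reals all_analysis.
From mathcomp Require Import lra.
Import Order.TTheory GRing.Theory Num.Theory.
Import numFieldNormedType.Exports.

(** The value function V of a problem is the largest function that obeys two
rules: V p is at most the terminal cost at p, and V p is at most c whenever some
input u guarantees that running cost plus V at the successor stays below c for
every successor of p under u.

V obeys them ([value_function_le_tcost], [value_function_le_step]) because
controllers can be composed: after one step with input u, the composed
controller observes the new state q and then imitates a controller that is good
for q.  Maximality is an induction principle, [value_function_ind]: a predicate
Good p c that is stable under strict forms of both rules holds as soon as
V p < c.  Indeed, let a controller guarantee a cost s < c from p.  If Good p c
failed, then by the rules the controller would not stop at p and some successor
would be bad again, now for the remaining budget; iterating gives a closed loop
run that never stops, hence has infinite cost.  The argument is a
well-foundedness argument on the tree of runs, which may branch infinitely, so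
the bound c on the cost need not come with a bound on the stopping time.

That the value of an abstraction bounds V from above is the induction principle
for the abstraction, combined with the two rules for the original problem.

For the converse approximation, the induction principle is applied to the
original problem, with Good p c saying that for some r > 0 every abstraction of
conservatism at most r has value less than c at all its cells that meet the ball
of radius r about p ([bounded_at_scale_value]).  Stability under the rules is
where semi-continuity enters: a strict bound on a cost persists in a
neighborhood, cells of finite cost have diameter at most the conservatism, and
by upper semi-continuity the successors of nearby states under nearby inputs lie
near the compact set F(p,u), on which a single scale r works.  If V p is finite,
the upper bound W therefore exceeds V p near p by less than the tolerance, if at
all, and a point of its hypograph is close to a point of the hypograph of V
above p itself; if V p is infinite, the whole line above p is available. *)

Local Open Scope classical_set_scope.
Local Open Scope ring_scope.

Set Implicit Arguments.
Unset Strict Implicit.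
Unset Printing Implicit Defensive.

(** * Suprema of nonnegative quantities *)

Section Supremum.
Context {R : realType}.
Implicit Types A : set (\bar R).

Lemma esup0_ge0 A : (0 <= esup0 A)%E.
Proof. by apply: ereal_sup_ubound; left. Qed.

Lemma esup0_ub A c : A c -> (c <= esup0 A)%E.
Proof. by move=> Ac; apply: ereal_sup_ubound; right. Qed.

Lemma esup0_le A b :
  (0 <= b)%E -> (forall c, A c -> (c <= b)%E) -> (esup0 A <= b)%E.
Proof. by move=> b0 Ab; apply: ge_ereal_sup => c [->|/Ab]. Qed.

End Supremum.

(** * Costs and values *)

Local Arguments cost : simpl never.

Section Cost.
Context {R : realType} {X U : Type} (P : ocp R X U).
Implicit Types (u : nat -> U) (v : nat -> bool) (x : nat -> X).

Lemma cost_ge0 w : (0 <= cost P w)%E.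
Proof.
case: w => [[u v] x]; rewrite /cost; case: pselect => // h.
apply: adde_ge0; first exact: tcost_ge0.
by apply: sume_ge0 => i _; exact: rcost_ge0.
Qed.

Lemma cost_stop u v x : v 0%N -> cost P (u, v, x) = tcost P (x 0%N).
Proof.
move=> v0; rewrite /cost; case: pselect => [h|[]]; last by exists 0%N.
case: ex_minnP => T _ /(_ _ v0); rewrite leqn0 => /eqP ->.
by rewrite big_ord0 adde0.
Qed.

Lemma cost_step u v x : v 0%N = false ->
  cost P (u, v, x) = (rcost P (x 0%N) (x 1%N) (u 0%N) +
    cost P (fun t => u t.+1, fun t => v t.+1, fun t => x t.+1))%E.
Proof.
move=> v0; rewrite /cost; case: pselect => [h|nh]; case: pselect => [h'|nh'].
- case: ex_minnP => T vT minT; case: ex_minnP => T' vT' minT'.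
  have -> : T = T'.+1.
    case: T vT minT => [|T vT minT]; first by rewrite v0.
    by apply/eqP; rewrite eqSS eqn_leq minT' // -ltnS minT.
  by rewrite big_ord_recl /= addeCA.
- by exfalso; case: h => -[|t vt]; [rewrite v0 | case: nh'; exists t].
- by exfalso; case: h' => t vt; case: nh; exists t.+1.
- by rewrite addey // -ltNye (lt_le_trans _ (rcost_ge0 _ _ _ _)).
Qed.

Lemma cost_never u v x : (forall t, v t = false) -> cost P (u, v, x) = +oo%E.
Proof.
move=> v0; rewrite /cost; case: pselect => // h.
by exfalso; case: h => t; rewrite v0.
Qed.

Lemma value_function_ge0 p : (0 <= value_function P p)%E.
Proof. by apply: le_ereal_inf_tmp => _ [C ->]; exact: esup0_ge0. Qed.

Lemma value_function_le (C : controller X U) p (c : \bar R) : (0 <= c)%E ->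
  (forall w, behavior_at C P p w -> (cost P w <= c)%E) ->
  (value_function P p <= c)%E.
Proof.
move=> c0 Cc; apply: le_trans (_ : esup0 _ <= c)%E.
  by apply: ereal_inf_lbound; exists C; reflexivity.
by apply: esup0_le => // _ [w /Cc ? <-].
Qed.

(** The guarantee is a real number strictly below c; this slack is what the
induction principle distributes over the steps of a run. *)
Lemma value_function_lt p (c : \bar R) : (value_function P p < c)%E ->
  exists (C : controller X U) (s : R),
    (s%:E < c)%E /\ forall w, behavior_at C P p w -> (cost P w <= s%:E)%E.
Proof.
move=> /ereal_inf_lt[_ [C ->]] sc.
exists C, (fine (esup0 (cost P @` behavior_at C P p))).
rewrite fineK; last first.
  by rewrite ge0_fin_numE ?esup0_ge0 // (lt_le_trans sc) ?leey.
by split=> // w Cw; apply: esup0_ub; exists w.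
Qed.

End Cost.

(** * Induction on the value function *)

Section Induction.
Context {R : realType} {X U : Type} (P : ocp R X U).

(** The controller state at time 0 is an arbitrary z, not necessarily an initial
one, so that the tail of a run is again a run. *)
Definition runs_from (C : controller X U) (z : ctrl_Z C) (p : X) :
    set ((nat -> U) * (nat -> bool) * (nat -> X)) :=
  [set w | w.2 0%N = p /\ system_solution P w.1.1 w.2 /\
    exists zs, zs 0%N = z /\
      forall t, ctrl_H (zs t) (ctrl_incl C (w.2 t))
                  (zs t.+1, w.1.1 t, w.1.2 t)].

Lemma runs_from_behavior (C : controller X U) (z : ctrl_Z C) p :
  ctrl_Z0 z -> runs_from z p `<=` behavior_at C P p.
Proof.
move=> Z0z w [x0 [sol [zs [z0 Hz]]]]; split=> //; exists zs; split=> //.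
by split=> [t||//]; [exact: ctrl_H_input (Hz t) | rewrite z0].
Qed.

(** Both the plant and the controller are strict, hence never block; without
this the guarantees below could hold vacuously. *)
Lemma runs_from_nonempty (C : controller X U) (z : ctrl_Z C) p :
  runs_from z p !=set0.
Proof.
have /choice[f fP] (s : ctrl_Z C * X) : exists r : ctrl_Z C * U * bool * X,
    ctrl_H s.1 (ctrl_incl C s.2) r.1 /\ trans P s.2 r.1.1.2 r.2.
  have [[[z' u] v] Hz] := ctrl_H_strict s.1 (ctrl_incl C s.2).
  by have [q Fq] := trans_strict P s.2 u; exists ((z', u, v), q).
pose s := fix s t := if t is t'.+1 then let r := f (s t') in (r.1.1.1, r.2)
                     else (z, p).
exists (fun t => (f (s t)).1.1.2, fun t => (f (s t)).1.2, fun t => (s t).2).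
split=> //; split=> [t|]; first exact: (fP (s t)).2.
exists (fun t => (s t).1); split=> // t /=.
by have := (fP (s t)).1; case: (f (s t)) => [[[]]].
Qed.

Lemma runs_from_cons (C : controller X U) (z : ctrl_Z C) p z' u v q w :
  ctrl_H z (ctrl_incl C p) (z', u, v) -> trans P p u q -> runs_from z' q w ->
  runs_from z p (fun t => if t is t'.+1 then w.1.1 t' else u,
                   fun t => if t is t'.+1 then w.1.2 t' else v,
                   fun t => if t is t'.+1 then w.2 t' else p).
Proof.
move=> Hz Fq [x0 [sol [zs [z0 Hzs]]]]; split=> //; split.
  by case=> [|t] /=; [rewrite x0 | exact: sol].
exists (fun t => if t is t'.+1 then zs t' else z); split=> //.
by case=> [|t] /=; [rewrite z0 | exact: Hzs].
Qed.

Definition guaranteed (C : controller X U) (z : ctrl_Z C) p (s : R) :=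
  forall w, runs_from z p w -> (cost P w <= s%:E)%E.

Lemma guaranteed_stop (C : controller X U) (z : ctrl_Z C) p s z' u :
  guaranteed z p s -> ctrl_H z (ctrl_incl C p) (z', u, true) ->
  (tcost P p <= s%:E)%E.
Proof.
move=> Gs Hz; have [q Fq] := trans_strict P p u.
have [w /(runs_from_cons Hz Fq) wr] := runs_from_nonempty z' q.
by have := Gs _ wr; rewrite cost_stop.
Qed.

(** Every run from the successor extends backwards to a run from p, so the
remaining budget is the old one minus the running cost, which is finite because
some run from the successor exists. *)
Lemma guaranteed_step (C : controller X U) (z : ctrl_Z C) p s z' u q :
  guaranteed z p s -> ctrl_H z (ctrl_incl C p) (z', u, false) ->
  trans P p u q ->
  exists a : R, rcost P p q u = a%:E /\ guaranteed z' q (s - a).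
Proof.
move=> Gs Hz Fq.
have Gw w : runs_from z' q w -> (rcost P p q u + cost P w <= s%:E)%E.
  move=> wr; have := Gs _ (runs_from_cons Hz Fq wr).
  by rewrite cost_step //= wr.1; case: w wr => [[]].
have [w wr] := runs_from_nonempty z' q.
have gfin : rcost P p q u \is a fin_num.
  rewrite ge0_fin_numE ?rcost_ge0 // (le_lt_trans _ (ltry s)) //.
  by apply: le_trans (Gw _ wr); rewrite leeDl ?cost_ge0.
exists (fine (rcost P p q u)); rewrite fineK //; split=> // w' /Gw.
by rewrite EFinB fineK // leeBrDl.
Qed.

(** The pairs (p, c) with V p < c lie in every relation stable under stopping and
under one step.  A bad triple of controller state, plant state and budgets has a
bad successor, and an infinite chain of bad triples is a run that never stops
although its cost is guaranteed to be finite. *)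
Theorem value_function_ind (Good : X -> R -> Prop) :
  (forall p c, (tcost P p < c%:E)%E -> Good p c) ->
  (forall p u c c', c' < c ->
     (forall q, trans P p u q -> exists a b : R,
        [/\ (rcost P p q u < a%:E)%E, Good q b & a + b <= c']) -> Good p c) ->
  forall p c, (value_function P p < c%:E)%E -> Good p c.
Proof.
move=> Gstop Gstep p c Vc; have [C [s [+ Cs]]] := value_function_lt Vc.
rewrite lte_fin => sc.
have [z0 Z0] := ctrl_Z0_nonempty C; apply: contrapT => nG.
pose bad (m : ctrl_Z C * X * (R * R)) :=
  [/\ guaranteed m.1.1 m.1.2 m.2.1, m.2.1 < m.2.2 & ~ Good m.1.2 m.2.2].
have bad0 : bad (z0, p, (s, c)).
  by split=> // w /(runs_from_behavior Z0)/Cs.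
have /choice[f fP] (m : {m | bad m}) : exists r : U * {m | bad m},
    ctrl_H (sval m).1.1 (ctrl_incl C (sval m).1.2) ((sval r.2).1.1, r.1, false)
    /\ trans P (sval m).1.2 r.1 (sval r.2).1.2.
  case: m => -[[z q] [s1 c1]] /= [/= Gs s1c1 nG1].
  have [[[z' u] v] Hz] := ctrl_H_strict z (ctrl_incl C q).
  case: v Hz => Hz.
    by case: nG1; apply: Gstop; rewrite (le_lt_trans (guaranteed_stop Gs Hz)).
  apply: contrapT => nr; apply: nG1.
  (* The slack c1 - s1 is split in three: one part for the running cost, one
     for the successor's budget, one to keep the sum strictly below c1. *)
  pose d := (c1 - s1) / 3%:R.
  apply: (Gstep _ u _ (s1 + d + d)); first by rewrite /d; lra.
  move=> q' Fq; have [a [ga Gs']] := guaranteed_step Gs Hz Fq.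
  exists (a + d), (s1 - a + d); split; [by rewrite ga lte_fin /d; lra| |lra].
  apply: contrapT => nG'; apply: nr.
  have bad' : bad (z', q', (s1 - a, s1 - a + d)).
    by split=> //=; rewrite /d; lra.
  by exists (u, exist _ _ bad').
pose m := fix m t := if t is t'.+1 then (f (m t')).2 else exist _ _ bad0.
suff : (+oo <= s%:E)%E by [].
rewrite -(@cost_never _ _ _ P (fun t => (f (m t)).1) (fun=> false)
  (fun t => (sval (m t)).1.2)) //.
apply: Cs; apply: (runs_from_behavior Z0); split=> //; split=> [t|].
  exact: (fP (m t)).2.
by exists (fun t => (sval (m t)).1.1); split=> // t; exact: (fP (m t)).1.
Qed.

End Induction.

(** * The value function obeys the dynamic programming rules *)

Section Rules.
Context {R : realType} {X U : Type} (P : ocp R X U).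

Definition stop_controller (u : U) : controller X U.
Proof.
apply: (@Controller X U unit setT X id setT
  (fun _ _ => [set (tt, u, true)])) => //.
- by exists tt.
- by exists u.
- by move=> _ _; exists (tt, u, true).
Defined.

Lemma value_function_le_tcost p : (value_function P p <= tcost P p)%E.
Proof.
have [u] := input_nonempty P.
apply: (@value_function_le _ _ _ _ (stop_controller u)); first exact: tcost_ge0.
move=> [[u' v] x] [[zs [[_ _ Hz] _]] /= <-].
by rewrite cost_stop //; have [_ _ ->] := Hz 0%N.
Qed.

(** Apply u, then follow C q where q is the state observed next.  All the
controllers C q are simulated in parallel on the observed states, and the mode
selects whose outputs are used: None before the first step, Some None when q is
about to be observed, Some (Some q) afterwards.  Keeping every simulation in the
state avoids a state type that depends on q. *)
Definition step_controller (u : U) (C : X -> controller X U) : controller X U.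
Proof.
apply: (@Controller X U (option (option X) * (forall q, ctrl_Z (C q)))
  [set s | s.1 = None /\ forall q, ctrl_Z0 (s.2 q)] X id setT
  (fun s x => [set r | match s.1 with
     | None => r = (Some None, s.2, u, false)
     | Some m => let q := odflt x m in r.1.1.1 = Some (Some q) /\
         exists a : X -> U * bool,
           (forall q', ctrl_H (s.2 q') (ctrl_incl (C q') x)
                         (r.1.1.2 q', (a q').1, (a q').2)) /\
           (r.1.2, r.2) = a q
     end])) => //.
- exists (None, fun q => projT1 (cid (ctrl_Z0_nonempty (C q)))).
  by split=> // q /=; case: cid.
- by exists u.
- move=> [[m|] f] x /=; last by exists (Some None, f, u, false).
  have Hne q := cid (ctrl_H_strict (f q) (ctrl_incl (C q) x)).
  pose r q := projT1 (Hne q).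
  exists (Some (Some (odflt x m)), fun q => (r q).1.1,
          (r (odflt x m)).1.2, (r (odflt x m)).2); split=> //.
  exists (fun q => ((r q).1.2, (r q).2)); split=> // q' /=.
  by rewrite /r; case: (Hne q') => /= -[[]].
Defined.

(** The tail of a closed loop run is a run of C q, where q is the state reached
after one step. *)
Lemma step_controller_behavior (u : U) (C : X -> controller X U) p w :
  behavior_at (step_controller u C) P p w ->
  [/\ w.1.1 0%N = u, w.1.2 0%N = false, w.2 0%N = p, trans P p u (w.2 1%N) &
      behavior_at (C (w.2 1%N)) P (w.2 1%N)
        (fun t => w.1.1 t.+1, fun t => w.1.2 t.+1, fun t => w.2 t.+1)].
Proof.
case: w => [[u' v] x] [[zs [[/= _ [zs0 Z0zs] Hz] sol]] /= x0].
have := Hz 0%N; rewrite zs0 => -[zs1 u0 v0].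
(* From time 1 on, the selected simulation is the one of x 1. *)
have zsE t : exists m, (zs t.+1).1 = Some m /\ odflt (x t.+1) m = x 1%N.
  elim: t => [|t [m [zst qt]]]; first by exists None; rewrite zs1.
  have := Hz t.+1; rewrite zst => -[/= zst2 _].
  by exists (Some (x 1%N)); rewrite zst2 qt.
have H1 t : ctrl_H ((zs t.+1).2 (x 1%N)) (ctrl_incl (C (x 1%N)) (x t.+1))
    ((zs t.+2).2 (x 1%N), u' t.+1, v t.+1).
  have [m [zst qt]] := zsE t; have := Hz t.+1; rewrite zst qt.
  by move=> [/= _ [a [Ha aE]]]; have := Ha (x 1%N); rewrite -aE.
split=> //; first by rewrite -x0 -u0; exact: sol.
split=> //; exists (fun t => (zs t.+1).2 (x 1%N)); split; last first.
  by move=> t; exact: sol.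
by split=> [t||t]; [exact: ctrl_H_input (H1 t) | rewrite zs1 | exact: H1].
Qed.

Lemma value_function_le_step p u (c : R) :
  (forall q, trans P p u q -> exists a b : R,
     [/\ (rcost P p q u <= a%:E)%E, (value_function P q < b%:E)%E &
         a + b <= c]) ->
  (value_function P p <= c%:E)%E.
Proof.
move=> stepP.
have /choice[C CP] (q : X) : exists C : controller X U, trans P p u q ->
    forall w, behavior_at C P q w -> (rcost P p q u + cost P w <= c%:E)%E.
  have [Fq|nFq] := pselect (trans P p u q); last by exists (stop_controller u).
  have [a [b [ga Vb abc]]] := stepP q Fq.
  have [C [s [sb Cs]]] := value_function_lt Vb; exists C => _ w /Cs ws.
  by apply: le_trans (leeD ga (le_trans ws (ltW sb))) _; rewrite -EFinD lee_fin.
have c0 : (0 <= c%:E)%E.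
  have [q Fq] := trans_strict P p u; have [a [b [ga Vb abc]]] := stepP q Fq.
  have a0 := le_trans (rcost_ge0 P p q u) ga.
  have b0 := le_trans (value_function_ge0 P q) (ltW Vb).
  by apply: le_trans (adde_ge0 a0 b0) _; rewrite -EFinD lee_fin.
apply: (@value_function_le _ _ _ _ (step_controller u C)) => //.
move=> [[u' v] x] /step_controller_behavior[/= u0 v0 x0 Fq Cw].
by rewrite cost_step // x0 u0; exact: CP Cw.
Qed.

End Rules.

(** * Abstractions overestimate the value *)

(** The value of the abstraction at a cell bounds V on the whole cell: the
induction principle reduces this to the two rules, which transfer from the
abstraction since its costs are larger and each successor q of a point of the
cell lies in some cell that is a successor of the cell. *)
Theorem value_function_le_upper_bound (R : realType) (X U : Type)
    (P : ocp R X U) (X2 : set (set X)) (U2 : set U) (P2 : ocp R X2 U2) :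
  abstraction P P2 ->
  forall x, (value_function P x <= upper_bound_of (value_function P2) x)%E.
Proof.
move=> [cover _ [_ vP]] x.
have memX2 y : exists A : X2, set_val A y.
  have [A XA Ay] : (\bigcup_(A in X2) A) y by rewrite cover.
  by exists (exist _ A (mem_set XA)).
have ubA (A : X2) (c : R) : (value_function P2 A < c%:E)%E ->
    forall y, set_val A y -> (value_function P y <= c%:E)%E.
  move: A c; apply: value_function_ind => [A c Gc y Ay|A u c c' c'c stepA y Ay].
    rewrite (le_trans (value_function_le_tcost _ _)) //.
    rewrite (le_trans _ (ltW Gc)) //.
    have [u] := input_nonempty P2.
    by have [] := vP y A y A u Ay Ay.
  apply: (@value_function_le_step _ _ _ _ _ (set_val u)) => q Fq.
  have [A' A'q] := memX2 q; have [_ gg FF] := vP y A q A' u Ay A'q.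
  have [|a [b [ga Vb abc]]] := stepA A'; first by apply: FF; exists q.
  exists a, (b + (c - c')); split; last lra.
    by rewrite (le_trans gg) // ltW.
  by rewrite (le_lt_trans (Vb _ A'q)) // lte_fin; lra.
have [A Ax] := memX2 x.
apply: le_trans (_ : value_function P2 A <= _)%E; last first.
  by apply: esup0_ub; exists A.
have [fA|] := boolP (value_function P2 A \is a fin_num); last first.
  rewrite ge0_fin_numE ?value_function_ge0 // -leNgt leye_eq => /eqP->.
  by rewrite leey.
rewrite -(fineK fA); apply/lee_addgt0Pr => e e0.
by apply: (ubA A) => //; rewrite -{1}(fineK fA) lte_fin ltrDl.
Qed.

(** * Local bounds that are uniform over abstractions *)

Section Conservatism.
Context {R : realType} {X U : metricType R} (P : ocp R X U).

Lemma usc_lt_open (T : topologicalType) (f : T -> \bar R) (a : R) :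
  usc f -> open [set t | (f t < a%:E)%E].
Proof.
move=> uf; rewrite -[X in open X]setCK openC.
have -> : ~` [set t | (f t < a%:E)%E] = (fun t => (t, a)) @^-1` hypo f.
  by apply/seteqP; split=> t /=; rewrite /hypo /= leNgt => /negP.
apply: closed_comp uf => t _.
exact: (cvg_pair cvg_id (cvg_cst a)).
Qed.

Lemma mdist_le_diam (M : set X) (r : R) x y :
  (diam M <= r%:E)%E -> M x -> M y -> mdist x y <= r.
Proof.
move=> dM Mx My; rewrite -lee_fin; apply: le_trans dM.
by apply: esup0_ub; exists x => //; exists y.
Qed.

(** One point of finite cost in a cell is enough to make the diameter bound and
the bound on the overestimation of successors available for that cell. *)
Lemma conservatism_of_finite (X2 : set (set X)) (U2 : set U) (P2 : ocp R X2 U2)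
    (rho : R) (A : X2) x :
  abstraction_of_conservatism P P2 rho -> set_val A x ->
  (tcost P x < +oo)%E \/ (exists y u, rcost P x y u < +oo)%E ->
  (diam (set_val A) <= rho%:E)%E /\
  forall u, P2 A u `<=` [set A' | (setdist (set_val A')
             (\bigcup_(p in set_val A) P p (set_val u)) <= rho%:E)%E].
Proof.
move=> [_ _ _ cons] Ax fin.
have neq : (tcost P @` set_val A) `|`
    [set c | exists p q a, set_val A p /\ c = rcost P p q a] <> [set +oo%E].
  move/seteqP => [sub _]; case: fin => [Gx|[y [u gx]]].
    have /sub : (tcost P @` set_val A `|`
      [set c | exists p q a, set_val A p /\ c = rcost P p q a]) (tcost P x).
      by left; exists x.
    by move=> /= Gxoo; rewrite Gxoo ltxx in Gx.
  have /sub : (tcost P @` set_val A `|`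
    [set c | exists p q a, set_val A p /\ c = rcost P p q a]) (rcost P x y u).
    by right; exists x, y, u.
  by move=> /= gxoo; rewrite gxoo ltxx in gx.
split=> [|u]; last by have [_ _ _ /(_ neq)[]] := cons A A u.
have [u] := input_nonempty P2.
by have [_ _ _ /(_ neq)[]] := cons A A u.
Qed.

(** The same r is a radius about p and a bound on the conservatism, so that the
property weakens as r decreases.  The diameter bound is carried along since the
step rule needs it for successor cells. *)
Definition bounded_at_scale (p : X) (c r : R) :=
  forall (X2 : set (set X)) (U2 : set U) (P2 : ocp R X2 U2) (rho : R),
    abstraction_of_conservatism P P2 rho -> rho <= r ->
  forall (A : X2) x, ball p r x -> set_val A x ->
    (diam (set_val A) <= rho%:E)%E /\ (value_function P2 A < c%:E)%E.

Lemma bounded_at_scale_le p c r q r' : r' <= r -> ball q r' `<=` ball p r ->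
  bounded_at_scale p c r -> bounded_at_scale q c r'.
Proof.
move=> r'r qp Br X2 U2 P2 rho cons rhor' A x /qp px Ax.
exact: (Br _ _ _ _ cons (le_trans rhor' r'r) _ _ px Ax).
Qed.

Hypothesis usc_rcost : usc (fun q : X * X * U => rcost P q.1.1 q.1.2 q.2).
Hypothesis usc_tcost : usc (tcost P).
Hypothesis usc_trans : set_usc (fun q : X * U => P q.1 q.2).
Hypothesis compact_trans : forall x u, compact (P x u).

(** Near p the terminal cost is below some c' < c; a small cell meeting a small
ball about p stays in that neighborhood, and its terminal cost is overestimated
by at most the conservatism. *)
Lemma bounded_at_scale_stop p c : (tcost P p < c%:E)%E ->
  exists r, 0 < r /\ bounded_at_scale p c r.
Proof.
move=> Gc.
have Gfin : tcost P p \is a fin_num.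
  by rewrite ge0_fin_numE ?tcost_ge0 // (lt_trans Gc) ?ltry.
move: Gc; rewrite -(fineK Gfin) lte_fin => Gc.
pose c' := (fine (tcost P p) + c) / 2.
have Gc' : (tcost P p < c'%:E)%E by rewrite -(fineK Gfin) lte_fin /c'; lra.
have /nbhs_ballP[e /= e0 eP] : nbhs p [set x | (tcost P x < c'%:E)%E].
  by apply: open_nbhs_nbhs; split=> //; exact: usc_lt_open.
have c'c : c' < c by rewrite /c'; lra.
pose r := Num.min (e / 2) ((c - c') / 2).
have re : r <= e / 2 by rewrite /r ge_min lexx.
have rc : r <= (c - c') / 2 by rewrite /r ge_min lexx orbT.
exists r; split; first by rewrite /r lt_min; apply/andP; split; lra.
move=> X2 U2 P2 rho cons rhor A x px Ax.
have pxe : ball p e x by apply: le_ball px; lra.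
have [|dA _] := conservatism_of_finite cons Ax.
  by left; rewrite (lt_trans (eP _ pxe)) ?ltry.
split=> //; have [u] := input_nonempty P2.
have [_ _ rho0 /(_ A A u)[_ G2 _ _]] := cons.
apply: le_lt_trans (value_function_le_tcost _ _) _.
apply: le_lt_trans G2 _; apply: (@le_lt_trans _ _ (rho%:E + c'%:E)%E).
  rewrite leeD2l //; apply: esup0_le => [|_ [y Ay <-]].
    by rewrite (le_trans (tcost_ge0 P p)) // ltW.
  rewrite ltW //; apply: eP; move: px; rewrite !ballEmdist /= => px.
  have := mdist_le_diam dA Ax Ay; have := metric_triangle p x y; lra.
by rewrite -EFinD lte_fin; lra.
Qed.

(** Compactness of the set of successors of p under u yields one scale at which
the running cost and the value at cells near each successor are controlled.  A
conservative abstraction has an input close to u, and the successors under it of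
a cell near p meet small balls about successors of p, so the step rule applies
in the abstraction with the sums increased by at most the conservatism. *)
Lemma bounded_at_scale_step p u c c' : c' < c ->
  (forall q, P p u q -> exists a b : R,
     [/\ (rcost P p q u < a%:E)%E, exists r, 0 < r /\ bounded_at_scale q b r &
         a + b <= c']) ->
  exists r, 0 < r /\ bounded_at_scale p c r.
Proof.
move=> c'c stepP.
pose uniform (r : R) (q : X) := exists a b : R, [/\ a + b <= c',
  forall x y w, ball p r x -> ball u r w -> ball q r y ->
    (rcost P x y w < a%:E)%E & bounded_at_scale q b r].
have [r [r0 rP]] : exists r, 0 < r /\ P p u `<=` uniform r.
  (* Near q the constants a and b chosen for q still work, at half the scale. *)
  have cov : \forall r \near 0^'+, P p u `<=` uniform r.
    move/compact_near_coveringP: (compact_trans (x := p) (u := u)); apply.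
    move=> q /stepP[a [b [ga [r1 [r10 Br1]] abc']]].
    have : nbhs (p, q, u) [set t | (rcost P t.1.1 t.1.2 t.2 < a%:E)%E].
      by apply: open_nbhs_nbhs; split=> //; exact: usc_lt_open usc_rcost.
    move=> /nbhs_ballP[r2 /= r20 r2P].
    pose r := Num.min r1 r2.
    have rr1 : r <= r1 by rewrite /r ge_min lexx.
    have rr2 : r <= r2 by rewrite /r ge_min lexx orbT.
    have r0 : 0 < r by rewrite /r lt_min r10.
    exists (ball q (r / 2), [set s | s < r / 2]).
      split; first by apply: nbhsx_ballx; lra.
      by apply: nbhs_right_lt; lra.
    move=> [q' s] /= [qq' sr].
    have qq's : ball q' s `<=` ball q r.
      move=> y q'y; rewrite [r]splitr; apply: ball_triangle qq' _.
      by apply: le_ball q'y; exact: ltW.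
    exists a, b; split=> // [x y w px uw q'y|].
      apply: (r2P (x, y, w)); split; first split => /=.
      - by apply: le_ball px; lra.
      - by apply: le_ball (qq's _ q'y).
      - by apply: le_ball uw; lra.
    apply: bounded_at_scale_le Br1; first lra.
    by move=> y /qq's; exact: le_ball.
  have [r [? ?]] := filter_ex (filterI (nbhs_right_gt (0 : R)) cov).
  by exists r.
have [r1 [r10 r1P]] : exists r1, 0 < r1 /\ forall x w y,
    ball p r1 x -> ball u r1 w -> P x w y ->
    exists2 q, P p u q & ball q (r / 4) y.
  (* Upper semi-continuity, applied to the closed complement of a neighborhood
     of the set of successors of p under u. *)
  pose A := \bigcup_(q in P p u) (ball q (r / 4))^°.
  have Aop : open A by apply: bigcup_open => q _; exact: open_interior.
  have : nbhs (p, u) (~` [set t | P t.1 t.2 `&` ~` A !=set0]).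
    apply: open_nbhs_nbhs; split.
      by rewrite openC; apply: usc_trans; rewrite closedC.
    move=> [q [/= Fq]]; apply; exists q => //; apply: nbhsx_ballx; lra.
  move=> /nbhs_ballP[r1 /= r10 r1P]; exists r1; split=> // x w y px uw Fy.
  apply: contrapT => nA; apply: (r1P (x, w)) => //; exists y; split=> //.
  by move=> [q Fq /interior_subset qy]; apply: nA; exists q.
(* A successor cell is at distance less than 2 s from a point within r / 4 of
   some q and has diameter at most s, so with s <= r / 8 it lies in the ball of
   radius r about q.  The cell A lies in the ball of radius 2 s about p. *)
pose s := Num.min (Num.min (r / 8) (r1 / 4)) ((c - c') / 2).
have sr : s <= r / 8 by rewrite /s !ge_min lexx.
have sr1 : s <= r1 / 4 by rewrite /s !ge_min lexx orbT.
have sc : s <= (c - c') / 2 by rewrite /s !ge_min lexx !orbT.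
have s0 : 0 < s by rewrite /s !lt_min; do !(apply/andP; split); lra.
exists s; split=> // X2 U2 P2 rho cons rhos A x px Ax.
have [_ _ rho0 consP] := cons.
have [q0 Fq0] := trans_strict P p u.
have ballpp : ball u r u by apply: ballxx.
have xfin : (exists y w, rcost P x y w < +oo)%E.
  have [a [b [_ ga _]]] := rP _ Fq0; exists q0, u.
  apply: lt_trans (ga _ _ _ _ _ _) (ltry a) => //; last exact: ballxx.
  by apply: le_ball px; lra.
have [dA distA] := conservatism_of_finite cons Ax (or_intror xfin).
split=> //.
have pA y : set_val A y -> mdist p y < 2 * s.
  move=> Ay; move: px; rewrite ballEmdist /=.
  have := mdist_le_diam dA Ax Ay; have := metric_triangle p x y; lra.
have [u0] := input_nonempty P2.
have [+ _ _ _] := consP A A u0 => /seteqP[/(_ u I)[w U2w wu] _].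
pose u2 : U2 := exist _ w (mem_set U2w).
apply: le_lt_trans (_ : (_ <= (c' + s)%:E)%E) _; last by rewrite lte_fin; lra.
apply: (@value_function_le_step _ _ _ _ _ u2) => A' FA'.
have [_ _ g2 _] := consP A A' u2.
have : (setdist (set_val A') (\bigcup_(p in set_val A) P p w) < (2 * s)%:E)%E.
  by apply: le_lt_trans (distA u2 _ FA') _; rewrite lte_fin; lra.
move=> /ereal_inf_lt[_ [y'' A'y''] [y [x' Ax' Fy] <-]]; rewrite lte_fin => y''y.
have uw : mdist u w <= rho by rewrite metric_sym.
have [q Fq] : exists2 q, P p u q & ball q (r / 4) y.
  apply: r1P Fy; rewrite ballEmdist /=; last lra.
  by have := pA _ Ax'; lra.
rewrite ballEmdist /= => qy.
have qy'' : mdist q y'' < r / 2.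
  have := metric_triangle q y y''; rewrite (metric_sym y y''); lra.
have [a [b [abc' ga Bq]]] := rP _ Fq.
have [|||dA' VA'] := Bq _ _ _ _ cons _ A' y''.
- lra.
- by rewrite ballEmdist /=; lra.
- by [].
(* The conservatism is charged to the running cost. *)
exists (rho + a), b; split=> //; last lra.
apply: le_trans g2 _; rewrite EFinD leeD2l //.
have a0 : (0 <= a%:E)%E.
  apply: le_trans (rcost_ge0 P p q u) (ltW _).
  by apply: ga => //; exact: ballxx.
apply: esup0_le => // _ [x1 Ax1 [y1 Ay1 <-]].
rewrite ltW //; apply: ga; rewrite ballEmdist /=.
- by have := pA _ Ax1; lra.
- lra.
- have := mdist_le_diam dA' A'y'' Ay1; have := metric_triangle q y'' y1; lra.
Qed.

Lemma bounded_at_scale_value p c : (value_function P p < c%:E)%E ->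
  exists r, 0 < r /\ bounded_at_scale p c r.
Proof.
move: p c; apply: value_function_ind; first exact: bounded_at_scale_stop.
exact: bounded_at_scale_step.
Qed.

(** A point (x, g) of the hypograph of the upper bound, with x near p, is close
to (p, min g (V p)), or to (p, g) if V is infinite at p. *)
Lemma hypo_upper_bound_approx (p : X) (eps : R) : 0 < eps ->
  exists (N : set X) (rho : R), [/\ nbhs p N, 0 < rho &
    forall (X2 : set (set X)) (U2 : set U) (P2 : ocp R X2 U2),
      abstraction_of_conservatism P P2 rho ->
      (N `*` setT) `&` hypo (upper_bound_of (value_function P2))
        `<=` balls (hypo (value_function P)) eps].
Proof.
move=> e0; have [Vfin|] := boolP (value_function P p \is a fin_num); last first.
  rewrite ge0_fin_numE ?value_function_ge0 // -leNgt leye_eq => /eqP Voo.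
  exists (ball p eps), 1; split=> //; first exact: nbhsx_ballx.
  move=> X2 U2 P2 _ [x g] [[/= px _] _]; exists (p, g).
    by rewrite /hypo /= Voo leey.
  by split=> //=; exact: ballxx.
pose v := fine (value_function P p).
have VE : value_function P p = v%:E by rewrite fineK.
have [|r [r0 Br]] := @bounded_at_scale_value p (v + eps / 2).
  by rewrite VE lte_fin; lra.
exists (ball p (Num.min r eps)), r; split=> //.
  by apply: nbhsx_ballx; rewrite lt_min r0.
move=> X2 U2 P2 cons [x g] [[/= px _]]; rewrite /hypo /= => gW.
have gv : g <= v + eps / 2.
  rewrite -lee_fin; apply: le_trans gW _; apply: esup0_le.
    rewrite lee_fin; have := value_function_ge0 P p; rewrite VE lee_fin; lra.
  move=> _ [A /= Ax <-]; apply: ltW.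
  have [] := Br _ _ _ _ cons (lexx r) A x _ Ax => //.
  by apply: le_ball px; rewrite ge_min lexx.
exists (p, Num.min g v); first by rewrite /hypo /= VE lee_fin ge_min lexx orbT.
split=> /=; first by apply: le_ball px; rewrite ge_min lexx orbT.
rewrite /ball /= ltr_norml; case: (leP g v) => ?; apply/andP; split; lra.
Qed.

End Conservatism.

(** * The theorem *)

Theorem mainTheorem7 (R : realType) :
  (forall (X U : Type) (P : ocp R X U)
      (X2 : set (set X)) (U2 : set U) (P2 : ocp R X2 U2),
    abstraction P P2 ->
    forall x : X,
      (value_function P x <= upper_bound_of (value_function P2) x)%E)
  /\
  (forall (X U : metricType R) (P : ocp R X U),
    proper_metric X ->
    compact [set: U] ->
    (forall x u, compact (P x u)) ->
    usc (fun q : X * X * U => rcost P q.1.1 q.1.2 q.2) ->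
    usc (tcost P) ->
    set_usc (fun q : X * U => P q.1 q.2) ->
    forall (p : X) (eps : R), 0 < eps ->
    exists (N : set X) (rho : R),
      [/\ nbhs p N, 0 < rho &
        forall (X2 : set (set X)) (U2 : set U) (P2 : ocp R X2 U2),
          abstraction_of_conservatism P P2 rho ->
          (N `*` setT) `&` hypo (upper_bound_of (value_function P2))
            `<=` balls (hypo (value_function P)) eps]).
Proof.
split=> [X U P X2 U2 P2|]; first exact: value_function_le_upper_bound.
move=> X U P _ _ Fcompact usc_g usc_G usc_F p eps eps0.
exact: hypo_upper_bound_approx.
Qed.
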